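(* Let $t\ge 1$ and $n\ge 2t+1$ be integers. Then $$D_R(G^0(n;t))=-\frac{4}{3}t^2+\left(\frac{4}{3}n-\frac{14}{3}\right)t+3n^2-7n+4.$$
   Context: All graphs are finite and simple. For a connected graph $G$, $R_G(u,v)$ is the resistance distance between $u$ and $v$, i.e. the effective resistance between $u$ and $v$ when every edge of $G$ is replaced by a unit resistor, and $d_G(u)$ is the degree of $u$. The degree resistance distance is $$D_R(G)=\sum_{\{u,v\}\subseteq V(G)}[d_G(u)+d_G(v)]\,R_G(u,v).$$ $G^0(n;t)$ is the graph on $n$ vertices consisting of $t$ triangles $C_3$ and a star $S_{n-2t}$ on $n-2t$ vertices (i.e. $n-2t-1$ pendent edges), where all the triangles and the star share exactly one common vertex $v_1$, which is the center of the star. *)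

(* Defs.v *)
From HB Require Import structures.
From mathcomp Require Import all_boot all_order all_algebra.
From mathcomp Require Import all_classical all_reals.
Set Implicit Arguments.
Unset Strict Implicit.
Unset Printing Implicit Defensive.
Import Order.TTheory GRing.Theory Num.Theory.
Local Open Scope ring_scope.

Record sgraph (V : finType) := SGraph {
  adj :> rel V;
  adj_sym : symmetric adj;
  adj_irr : irreflexive adj }.

Definition degree (V : finType) (G : sgraph V) (u : V) : nat := #|[set w | G u w]|.

(* [p] is the electric potential when every edge is a unit resistor, one unit
   of current enters at [u] and leaves at [v]: by Ohm's law the current along
   an edge [x y] is [p x - p y], and the net current out of [x] obeys
   Kirchhoff's law. *)
Definition unit_current_potential (R : realType) (V : finType) (G : sgraph V)
    (u v : V) (p : V -> R) : Prop :=
  forall x : V, \sum_(y | G x y) (p x - p y) = (x == u)%:R - (x == v)%:R.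

(* The potential drop from [u] to [v] under a unit current. When [G] is
   connected such a potential exists; the drop never depends on its choice
   ([resistanceE]). The default value 0 of [xget] is used only when [u] and
   [v] lie in different components. *)
Definition resistance (R : realType) (V : finType) (G : sgraph V) (u v : V) : R :=
  xget 0 [set r : R | exists2 p : V -> R,
            unit_current_potential G u v p & r = p u - p v]%classic.

Lemma unit_current_reciprocity (R : realType) (V : finType) (G : sgraph V)
    (u v : V) (p q : V -> R) :
  unit_current_potential G u v p -> unit_current_potential G u v q ->
  p u - p v = q u - q v.
Proof.
have drop (f : V -> R) : \sum_x f x * ((x == u)%:R - (x == v)%:R) = f u - f v.
  under eq_bigr do rewrite mulrBr.
  rewrite sumrB; congr (_ - _).
    by rewrite (bigD1 u) //= eqxx mulr1 big1 ?addr0 // => x /negbTE ->; rewrite mulr0.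
  by rewrite (bigD1 v) //= eqxx mulr1 big1 ?addr0 // => x /negbTE ->; rewrite mulr0.
have energy (f g : V -> R) : \sum_x f x * (\sum_(y | G x y) (g x - g y)) =
    \sum_x \sum_(y | G x y) f x * g x - \sum_x \sum_(y | G x y) f x * g y.
  rewrite -sumrB; apply: eq_bigr => x _; rewrite mulr_sumr -sumrB.
  by apply: eq_bigr => y _; rewrite mulrBr.
move=> pP qP; rewrite -(drop p) -(drop q).
under eq_bigr do rewrite -qP.
under [RHS]eq_bigr do rewrite -pP.
rewrite !energy; congr (_ - _).
  by apply: eq_bigr => x _; apply: eq_bigr => y _; rewrite mulrC.
rewrite [RHS](exchange_big_dep predT) //=; apply: eq_bigr => x _.
by apply: eq_big => [y|y _]; [rewrite adj_sym | rewrite mulrC].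
Qed.

Lemma resistanceE (R : realType) (V : finType) (G : sgraph V) (u v : V)
    (p : V -> R) :
  unit_current_potential G u v p -> resistance R G u v = p u - p v.
Proof.
move=> pP; rewrite /resistance; case: xgetP => [r _ [q qP ->]|no_r].
  exact: unit_current_reciprocity qP pP.
by case: (no_r (p u - p v)); exists p.
Qed.

(* The condition on ranks selects each unordered pair {u, v}, u <> v, once. *)
Definition degree_resistance_distance (R : realType) (V : finType)
    (G : sgraph V) : R :=
  \sum_(u : V) \sum_(v : V | (enum_rank u < enum_rank v)%N)
    (degree G u + degree G v)%:R * resistance R G u v.

(* On the vertices 0, ..., n-1 (meant for 2t+1 <= n): 0 is the common vertex,
   the k-th triangle (k < t) is {0, 2k+1, 2k+2}, and the star has center 0 and
   leaves 2t+1, ..., n-1. *)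
Definition in_triangle (k i : nat) : bool :=
  i \in [:: 0; k.*2.+1; k.*2.+2]%N.

Definition G0_adj (n t : nat) : rel 'I_n := fun i j =>
  [|| (i != j) && [exists k : 'I_t, in_triangle k i && in_triangle k j],
      (i == 0 :> nat) && (t.*2 < j)%N
    | (j == 0 :> nat) && (t.*2 < i)%N].

Fact G0_adj_sym (n t : nat) : symmetric (@G0_adj n t).
Proof.
move=> i j; rewrite /G0_adj eq_sym; congr (_ && _ || _); last exact: orbC.
by apply: eq_existsb => k; rewrite andbC.
Qed.

Fact G0_adj_irr (n t : nat) : irreflexive (@G0_adj n t).
Proof. by move=> i; rewrite /G0_adj eqxx /= orbb; case: eqP => //= ->. Qed.

Definition G0 (n t : nat) : sgraph 'I_n :=
  SGraph (@G0_adj_sym n t) (@G0_adj_irr n t).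

(* Main.v *)
Require Import Defs.
From mathcomp Require Import all_boot all_order all_algebra.
From mathcomp Require Import all_classical all_reals.
From mathcomp Require Import ring zify.
Import Order.TTheory GRing.Theory Num.Theory.
Local Open Scope ring_scope.

(** Let [f v] be the potential, grounded at the centre, of a unit current
    entering at [v] and leaving at the centre; it is supported on the block of
    [v].  By superposition [f u - f v] is a potential for the pair [u, v], so
    R(u,v) = f u u - f u v - f v u + f v v, and the sum over pairs factors into
    the single sums of d(u), f u u, d(u) f u u and of d(u) (\sum_v f u v),
    where \sum_v f u v = 1 for every [u] other than the centre. *)

Lemma unit_current_potentialB (R : realType) (V : finType) (G : sgraph V)
    (u v w : V) (p q : V -> R) :
  unit_current_potential G u w p -> unit_current_potential G v w q ->
  unit_current_potential G u v (fun x => p x - q x).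
Proof.
move=> pP qP x; transitivity (\sum_(y | G x y) (p x - p y) - \sum_(y | G x y) (q x - q y)).
  by rewrite -sumrB; apply: eq_bigr => y _; ring.
by rewrite pP qP; ring.
Qed.

Lemma sum_eq_op (R : pzRingType) (V : finType) (v : V) :
  \sum_(y : V) (y == v)%:R = 1 :> R.
Proof. by rewrite (bigD1 v) //= eqxx big1 ?addr0 // => y /negbTE ->. Qed.

(** The potentials below are combinations of point masses, so by linearity this column of the
    Laplacian is all that Kirchhoff's law requires. *)
Lemma laplacian_delta (R : realType) (V : finType) (G : sgraph V) (v x : V) :
  \sum_(y | G x y) ((x == v)%:R - (y == v)%:R) =
    (degree G v)%:R * (x == v)%:R - (G x v)%:R :> R.
Proof.
rewrite sumrB sumr_const; congr (_ - _).
  have [->|_] := eqVneq x v; last by rewrite mulr0n mul0rn mulr0.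
  by rewrite mulr1 /degree cardsE.
rewrite big_mkcond (bigD1 v) //= eqxx big1 ?addr0.
  by case: (G x v).
by move=> y /negbTE ->; case: ifP.
Qed.

Lemma degreeE (R : realType) (V : finType) (G : sgraph V) (v : V) :
  (degree G v)%:R = \sum_x (G x v)%:R :> R.
Proof.
rewrite /degree -sum1_card natr_sum big_mkcond; apply: eq_bigr => x _.
by rewrite inE adj_sym; case: (G x v).
Qed.

(** Split [d u + d v] and swap the two names in the second half: it then runs over the pairs in the
    opposite rank order. Both halves together miss only the diagonal, where [r] vanishes. *)
Lemma sum_enum_rank_lt (R : pzRingType) (V : finType) (d : V -> R)
    (r : V -> V -> R) :
  (forall u v, r u v = r v u) -> (forall u, r u u = 0) ->
  \sum_u \sum_(v | (enum_rank u < enum_rank v)%N) (d u + d v) * r u v =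
    \sum_u \sum_v d u * r u v.
Proof.
move=> rC r0.
under eq_bigr do (under eq_bigr do rewrite mulrDl); under eq_bigr do rewrite big_split.
rewrite big_split /= [X in _ + X](exchange_big_dep predT) //= -big_split /=.
apply: eq_bigr => u _.
rewrite [RHS](bigID (fun v => (enum_rank u < enum_rank v)%N)) /=; congr (_ + _).
rewrite [RHS](bigD1 u) ?ltnn //= r0 mulr0 add0r.
apply: eq_big => [v|v _]; last by rewrite rC.
rewrite -leqNgt ltn_neqAle andbC; congr (_ && ~~ _).
by apply/eqP/eqP => [/val_inj/enum_rank_inj|->].
Qed.

Section FriendshipStar.
Variables (R : realType) (m t : nat).
Hypothesis le_2t_m : (t.*2 <= m)%N.
Implicit Types u v x : 'I_m.+1.
Local Notation G := (G0 m.+1 t).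

(* Meaningful only for 0 < v <= 2t: the third vertex of the triangle of 0 and v. *)
Definition mate v : 'I_m.+1 := inord (if odd v then v.+1 else v.-1).

Lemma val_mate v :
  v != ord0 -> (v <= t.*2)%N -> mate v = (if odd v then v.+1 else v.-1) :> nat.
Proof. rewrite -val_eqE /= => v0 vt; rewrite /mate inordK //; case: ifP; lia. Qed.

Lemma mate_block v : v != ord0 -> (v <= t.*2)%N ->
  [/\ mate v != ord0, (mate v <= t.*2)%N, mate v != v & mate (mate v) = v].
Proof.
move=> v0 vt; have mv := val_mate v v0 vt.
have v_gt0 : (0 < v)%N by rewrite lt0n.
have m0 : mate v != ord0 by rewrite -val_eqE /= mv; case: ifP; lia.
have mt : (mate v <= t.*2)%N by rewrite mv; case: ifP; lia.
split=> //; first by rewrite -val_eqE /= mv; case: ifP; lia.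
by apply: val_inj; rewrite /= val_mate // mv; do 2 case: ifP; lia.
Qed.

(** This trades the existential over triangles for an explicit neighbour list; the row of the centre
    follows by symmetry of adjacency. *)
Lemma G0_adj_block x v : v != ord0 ->
  G x v = (x == ord0) || (v <= t.*2)%N && (x == mate v).
Proof.
move=> v0; have v0' : (0 < v)%N by rewrite lt0n.
have xm : (v <= t.*2)%N -> (x == mate v) = (x == (if odd v then v.+1 else v.-1) :> nat).
  by move=> vt; rewrite -val_eqE /= val_mate.
have -> : (v <= t.*2)%N && (x == mate v) =
   (v <= t.*2)%N && (x == (if odd v then v.+1 else v.-1) :> nat).
  by case: leqP => //= /xm.
rewrite /= /G0_adj -!val_eqE /= /in_triangle {xm}.
(* Only the parity disjunction [wE] about the mate is kept, in a form suited to [lia]. *)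
set w := if _ then _ else _.
have wE : odd v && (w == v.+1) || ~~ odd v && (w == v.-1).
  by rewrite /w; case: odd; rewrite eqxx.
clearbody w.
apply/idP/idP.
  case/or3P.
  - case/andP=> xv /existsP[k]; rewrite !inE => /andP[xk vk]; have := ltn_ord k.
    lia.
  - by case/andP=> ->.
  - lia.
case/orP => [/eqP x0|/andP[vt /eqP xE]].
  rewrite x0; have [vt|vt] := leqP v t.*2; last by rewrite orbT.
  (* Both [v = 2k+1] and [v = 2k+2] give [k = v.-1./2], the index of the triangle through [v]. *)
  have kt : (v.-1./2 < t)%N by lia.
  apply/orP; left; apply/andP; split; first by lia.
  by apply/existsP; exists (Ordinal kt); rewrite !inE /=; lia.
have kt : (v.-1./2 < t)%N by lia.
apply/orP; left; apply/andP; split; first by lia.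
by apply/existsP; exists (Ordinal kt); rewrite !inE /=; lia.
Qed.

Definition by_block (a b c : R) v : R :=
  if v == ord0 then a else if (v <= t.*2)%N then b else c.

Lemma sum_by_block (a b c : R) :
  \sum_v by_block a b c v = a + 2 * t%:R * b + (m%:R - 2 * t%:R) * c.
Proof.
rewrite big_ord_recl {1}/by_block eqxx -addrA; congr (_ + _).
(* With the centre removed, [i] stands for the vertex [i+1], so being at most [2t] becomes
   [i < 2t]. *)
rewrite (eq_bigr (fun i : 'I_m => if (i < t.*2)%N then b else c)) //.
rewrite -(big_mkord predT (fun i => if (i < t.*2)%N then b else c)).
rewrite (big_cat_nat (n := t.*2)) //=; congr (_ + _).
  rewrite big_nat_cond (eq_bigr (fun _ => b)) => [|i /andP[/andP[_ ->]] //].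
  rewrite -big_nat_cond sumr_const_nat subn0 -[b *+ _]mulr_natl -muln2 natrM; ring.
rewrite big_nat_cond (eq_bigr (fun _ => c)).
  rewrite -big_nat_cond sumr_const_nat -[c *+ _]mulr_natl natrB // -muln2 natrM; ring.
by move=> i /andP[/andP[ti _] _]; rewrite ltnNge ti.
Qed.

Lemma degree_G0 v : (degree G v)%:R = by_block m%:R 2 1 v.
Proof.
rewrite degreeE /by_block; have [->|v0] := eqVneq v ord0.
  rewrite big_ord_recl adj_irr add0r (eq_bigr (fun _ => 1)).
    by rewrite sumr_const card_ord.
  by move=> i _; rewrite adj_sym G0_adj_block // eqxx.
under eq_bigr do rewrite G0_adj_block //.
case: leqP => vt; last by under eq_bigr do rewrite orbF; rewrite sum_eq_op.
have [m0 _ _ _] := mate_block v v0 vt.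
transitivity (\sum_(x : 'I_m.+1) (x == ord0)%:R + \sum_x (x == mate v)%:R : R).
  rewrite -big_split; apply: eq_bigr => x _ /=.
  have [->|_] := eqVneq x ord0; last by rewrite add0r.
  by rewrite /= (eq_sym ord0) (negbTE m0) addr0.
by rewrite !sum_eq_op.
Qed.

(** In a triangle the current reaches the centre by an edge and by a path of two edges in parallel:
    the drop is 1 * 2 / (1 + 2) = 2/3, and the mate, midway along the path, sits at 1/3. At a leaf
    the single edge gives drop 1. *)
Definition centre_potential v x : R :=
  by_block 0 (2 / 3 * (x == v)%:R + 1 / 3 * (x == mate v)%:R) (x == v)%:R v.

Lemma centre_potentialP v :
  unit_current_potential G v ord0 (centre_potential v).
Proof.
move=> x; rewrite /centre_potential /by_block.
have [->|v0] := eqVneq v ord0; first by rewrite big1 ?subrr // => y _; rewrite subrr.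
case: leqP => vt; last first.
  rewrite laplacian_delta degree_G0 G0_adj_block // /by_block (negbTE v0).
  by rewrite leqNgt vt /= orbF mul1r.
have [m0 mt mv mm] := mate_block v v0 vt.
pose D w y : R := (x == w)%:R - (y == w)%:R.
rewrite (eq_bigr (fun y => 2 / 3 * D v y + 1 / 3 * D (mate v) y)); last first.
  by move=> y _; rewrite /D; ring.
rewrite big_split -!mulr_sumr /D !laplacian_delta !degree_G0 !G0_adj_block //.
rewrite /by_block (negbTE v0) (negbTE m0) vt mt mm /=.
(* Net currents in a triangle: -2/3 - 1/3 = -1 at the centre, 4/3 - 1/3 = 1 at [v], -2/3 + 2/3 = 0
   at the mate. *)
have [->|x0] := eqVneq x ord0.
  by rewrite !(eq_sym ord0) (negbTE v0) (negbTE m0) /=; field.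
have [->|xv] := eqVneq x v; first by rewrite (eq_sym v) (negbTE mv) /=; field.
by rewrite /=; case: (x == _) => /=; field.
Qed.

Lemma centre_potential_sym u v : centre_potential u v = centre_potential v u.
Proof.
have sub w z : w != ord0 -> (w <= t.*2)%N -> z == mate w -> w == mate z.
  by move=> w0 wt /eqP ->; have [_ _ _ ->] := mate_block w w0 wt.
rewrite /centre_potential /by_block.
(* Grounding at the centre matches the zero potential assigned to the source [ord0]. *)
have vanish w : w != ord0 -> 0 = if (w <= t.*2)%N then
    2 / 3 * (ord0 == w)%:R + 1 / 3 * (ord0 == mate w)%:R else (ord0 == w)%:R :> R.
  move=> w0; rewrite eq_sym (negbTE w0); case: leqP => // wt.
  by have [/negbTE m0 _ _ _] := mate_block w w0 wt; rewrite eq_sym m0 !mulr0 addr0.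
have [u0|u0] := eqVneq u ord0; have [v0|v0] := eqVneq v ord0 => //.
- by rewrite u0; apply: vanish.
- by rewrite v0; apply/esym/vanish.
have tri_leaf w z : w != ord0 -> (w <= t.*2)%N -> (t.*2 < z)%N ->
  2 / 3 * (z == w)%:R + 1 / 3 * (z == mate w)%:R = (z == w)%:R :> R.
  move=> w0 wt zt; have [_ mt _ _] := mate_block w w0 wt.
  have /negbTE -> : z != w by apply: contraTneq zt => ->; rewrite -leqNgt.
  have /negbTE -> : z != mate w by apply: contraTneq zt => ->; rewrite -leqNgt.
  by rewrite !mulr0 addr0.
rewrite (eq_sym v u); case: (leqP u) => ut; case: (leqP v) => vt //.
- by have -> : (u == mate v) = (v == mate u) by apply/idP/idP; apply: sub.
- by rewrite (eq_sym u v) tri_leaf.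
- by rewrite tri_leaf.
Qed.

(** By symmetry the sum over sources is the sum of the values of one potential: 2/3 + 1/3 in a
    triangle, 1 at a leaf. *)
Lemma sum_centre_potential u : \sum_v centre_potential v u = by_block 0 1 1 u.
Proof.
under eq_bigr do rewrite centre_potential_sym.
rewrite /centre_potential /by_block.
have [_|u0] := eqVneq u ord0; first by rewrite big1.
case: leqP => ut; last exact: sum_eq_op.
by rewrite big_split -!mulr_sumr /= !sum_eq_op; field.
Qed.

Lemma centre_potential_diag u : centre_potential u u = by_block 0 (2 / 3) 1 u.
Proof.
rewrite /centre_potential /by_block eqxx.
have [//|u0] := eqVneq u ord0; case: leqP => // ut.
have [_ _ /negbTE mu _] := mate_block u u0 ut.
by rewrite eq_sym mu mulr1 mulr0 addr0.
Qed.

Lemma resistance_G0 u v : resistance R G u v =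
  centre_potential u u - centre_potential v u -
  (centre_potential u v - centre_potential v v).
Proof.
by rewrite (resistanceE (unit_current_potentialB _ _ _ _ _ _ _ _
  (centre_potentialP u) (centre_potentialP v))).
Qed.

Lemma sum_by_blockM (a b c a' b' c' : R) :
  \sum_v by_block a b c v * by_block a' b' c' v =
    a * a' + 2 * t%:R * (b * b') + (m%:R - 2 * t%:R) * (c * c').
Proof.
rewrite -sum_by_block; apply: eq_bigr => v _; rewrite /by_block.
by case: ifP => // _; case: ifP.
Qed.

(** With [f] the centre potential and [n = m+1], the three terms are n times the sum of
    [d u * f u u], the product of the sums of [d] and of [f v v], and twice the degree sum off the
    centre. *)
Lemma degree_resistance_distance_G0 :
  degree_resistance_distance R G =
    m.+1%:R * (4 / 3 * (2 * t%:R) + (m%:R - 2 * t%:R))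
    + (2 * m%:R + 2 * t%:R) * (m%:R - 2 / 3 * t%:R)
    - 2 * (m%:R + 2 * t%:R).
Proof.
pose d u := by_block m%:R 2 1 u; pose f := centre_potential.
transitivity (\sum_u \sum_v d u * resistance R G u v).
  rewrite -sum_enum_rank_lt => [|u v|u]; last 2 first.
  - by rewrite !resistance_G0; ring.
  - by rewrite resistance_G0; ring.
  by apply: eq_bigr => u _; apply: eq_bigr => v _; rewrite natrD !degree_G0.
transitivity (\sum_u (m.+1%:R * (d u * f u u) + d u * \sum_v f v v
                       - 2 * (d u * \sum_v f v u))).
  apply: eq_bigr => u _; rewrite -mulr_sumr.
  transitivity (d u * \sum_v (f u u + f v v - 2 * f v u)).
    congr (_ * _); apply: eq_bigr => v _; rewrite resistance_G0.
    by rewrite (centre_potential_sym u v) /f; ring.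
  rewrite sumrB big_split /= sumr_const card_ord -mulr_sumr -mulr_natl; ring.
rewrite sumrB big_split /= -!mulr_sumr -mulr_suml.
under [\sum_v f v v]eq_bigr do rewrite /f centre_potential_diag.
under [in X in X + _ - _]eq_bigr do rewrite /f centre_potential_diag.
under [in X in _ - X]eq_bigr do rewrite /f sum_centre_potential.
by rewrite /d !sum_by_blockM !sum_by_block; field.
Qed.
End FriendshipStar.

Theorem mainTheorem4 (R : realType) (n t : nat)
    (ht : (1 <= t)%N) (hn : (2 * t + 1 <= n)%N) :
  degree_resistance_distance R (G0 n t) =
    - (4 / 3) * t%:R ^+ 2 + (4 / 3 * n%:R - 14 / 3) * t%:R
      + 3 * n%:R ^+ 2 - 7 * n%:R + 4.
Proof.
case: n hn => [|m] hn; first by lia.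
rewrite degree_resistance_distance_G0; last by lia.
by rewrite -[m.+1]addn1 natrD; field.
Qed.
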